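(* Let $G$ be a finite group, $K$ a field, and let $\mathcal{C}=(\mathcal{C},\theta)$ be a twisted Frobenius algebra bundle on $BG$ whose underlying algebra $\mathcal{C}$ is separable over $K$. Then the $0$-th Hochschild homology bundle $\mathcal{HH}_0(\mathcal{C})=\bigoplus_{g\in G}\mathcal{HH}_0(\mathcal{C})_g$, equipped with the $G$-action given by the operators $\mathcal{T}(g)$, the multiplication given by the maps $m_{g,h}$, and the functional $\theta_e:\mathcal{HH}_0(\mathcal{C})_e\to K$, $\theta_e(c)=\theta(c\,c_e)$, is a crossed $G$-algebra.
   Context: Throughout, $G$ is a finite group with unit element $e$ and $K$ is a field; all algebras, spaces and tensor products are over $K$. **Categorical action.** A categorical $G$-action on a unital associative algebra $\mathcal{C}$ consists of algebra automorphisms $\rho(g)$ of $\mathcal{C}$ ($g\in G$; write $g(c)=\rho(g)(c)$) and invertible elements $c_{g,h}\in\mathcal{C}$ ($g,h\in G$) and $c_e\in\mathcal{C}$ such that $\rho(g)\rho(h)=Ad(c_{g,h})\rho(gh)$ and $\rho(e)=Ad(c_e)$, where $Ad(c)(x)=cxc^{-1}$, and for all $g,h,k\in G$ $$c_{g,h}c_{gh,k}=g(c_{h,k})c_{g,hk},\quad c_{g,e}=g(c_e),\quad c_{e,g}=c_e.$$ (In particular $e(c)=\rho(e)(c)=c_e c c_e^{-1}$ need not equal $c$, and $gh(c)$ means $\rho(gh)(c)$.) **Twisted Frobenius algebra bundle on $BG$.** A finite-dimensional unital associative algebra $\mathcal{C}$ with a linear functional $\theta:\mathcal{C}\to K$ satisfying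 $\theta(ab)=\theta(ba)$, such that the pairing $(a,b)\mapsto\theta(ab)$ is non-degenerate, together with a categorical $G$-action satisfying $\theta(g(c))=\theta(c)$ for all $g\in G$, $c\in\mathcal{C}$. Let $\xi=\sum_i\xi_i'\otimes\xi_i''\in\mathcal{C}\otimes\mathcal{C}$ be the symmetric tensor inverse to the pairing: $c=\sum_i\xi_i'\,\theta(c\,\xi_i'')$ for all $c\in\mathcal{C}$. **Hochschild homology bundle.** For $h\in G$ let $\mathcal{C}_h=\mathrm{span}\{c_1c_2-c_2h(c_1)\mid c_1,c_2\in\mathcal{C}\}$, and set $\mathcal{HH}_0(\mathcal{C})_h=\mathcal{C}/\mathcal{C}_h$, $\mathcal{HH}_0(\mathcal{C})=\bigoplus_{h\in G}\mathcal{HH}_0(\mathcal{C})_h$. **Structure maps.** Each of the following linear maps descends to the indicated quotients. - $T_h(g):\mathcal{C}\to\mathcal{C}$, $T_h(g)(c)=c_e^{-1}c_{g,g^{-1}}^{-1}\,g(c)\,c_{g,h}\,c_{gh,g^{-1}}$, induces $\mathcal{T}_h(g):\mathcal{HH}_0(\mathcal{C})_h\to\mathcal{HH}_0(\mathcal{C})_{ghg^{-1}}$; $\mathcal{T}(g)$ is the operator on $\mathcal{HH}_0(\mathcal{C})$ whose restriction to $\mathcal{HH}_0(\mathcal{C})_h$ is $\mathcal{T}_h(g)$. - $m_{g,h}(c'\otimes c'')=\sum_i\xi_i'\,c'\,g(\xi_i''c'')\,c_{g,h}$ induces $m_{g,h}:\mathcal{HH}_0(\mathcal{C})_g\otimes\mathcal{HH}_0(\mathcal{C})_h\to\mathcal{HH}_0(\mathcal{C})_{gh}$.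 - $c\mapsto\theta(c\,c_e)$ induces $\theta_e:\mathcal{HH}_0(\mathcal{C})_e\to K$. **Crossed $G$-algebra (Turaev algebra).** A finite-dimensional $G$-graded vector space $C=\bigoplus_{g\in G}C_g$ together with a group homomorphism $G\to GL(C)$ (written $c\mapsto g(c)$) with $g(C_h)=C_{ghg^{-1}}$ for all $g,h$ and $g|_{C_g}=\mathrm{id}$ for all $g$, a $G$-invariant linear functional $\theta_e:C_e\to K$, and an associative algebra structure on $C$, such that: 1. $G$ acts by automorphisms of the algebra $C$; 2. $C_g\cdot C_h\subset C_{gh}$; 3. $c'c''=g(c'')c'$ for all $c'\in C_g$, $c''\in C_h$; 4. (torus axiom) for all $g,h\in G$ and $c\in C_{hgh^{-1}g^{-1}}$, $\mathrm{Tr}_{C_h}(L'_c\cdot g)=\mathrm{Tr}_{C_g}(h^{-1}\cdot L''_c)$, where $L'_c:C_{ghg^{-1}}\to C_h$ and $L''_c:C_g\to C_{hgh^{-1}}$ are the operators of left multiplication by $c$; 5. $C$ is unital; 6. $\theta_e$ induces a non-degenerate pairing $C_g\otimes C_{g^{-1}}\to K$, $(a,b)\mapsto\theta_e(ab)$, for every $g\in G$. *)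

(* Defs.v *)
From HB Require Import structures.
From mathcomp Require Import all_boot all_order all_fingroup all_algebra.
From mathcomp Require Import falgebra.

Set Implicit Arguments.
Unset Strict Implicit.
Unset Printing Implicit Defensive.

Import GRing.Theory VectorInternalTheory.
Local Open Scope ring_scope.
Local Open Scope quotient_scope.

(* Quotient V / U of a finite-dimensional space: the set-theoretic quotient   *)
(* by the relation x - y \in U, with \pi : V -> vquot U and its section repr. *)
Section QuotientSpace.
Variables (K : fieldType) (V : vectType K) (U : {vspace V}).

Definition vquot : Type := Quotient.quot (pred_of_vspace U).

HB.instance Definition _ := EqQuotient.on vquot.
HB.instance Definition _ := GRing.Zmodule.on vquot.

Definition vpi (x : V) : vquot := \pi x.
Definition vrepr (q : vquot) : V := generic_quotient.repr q.

Lemma vreprK : cancel vrepr vpi. Proof. exact: reprK. Qed.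

Lemma vpi_eq x y : (vpi x == vpi y) = (x - y \in U).
Proof. by rewrite Quotient.idealrBE. Qed.

Lemma vpiB : zmod_morphism vpi.
Proof.
move=> x y; rewrite /vpi; apply/eqP.
by rewrite Quotient.pi_add Quotient.pi_opp.
Qed.
HB.instance Definition _ := GRing.isZmodMorphism.Build V vquot vpi vpiB.

Definition vquot_scale (a : K) (q : vquot) : vquot := vpi (a *: vrepr q).

Lemma vpiZ a x : vpi (a *: x) = vquot_scale a (vpi x).
Proof.
apply/eqP; rewrite vpi_eq -scalerBr rpredZ // -vpi_eq; apply/eqP.
by rewrite vreprK.
Qed.

Fact vquot_scaleA a b q :
  vquot_scale a (vquot_scale b q) = vquot_scale (a * b) q.
Proof. by rewrite -[q]vreprK -!vpiZ scalerA. Qed.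
Fact vquot_scale1 : left_id 1 vquot_scale.
Proof. by move=> q; rewrite -[q]vreprK -!vpiZ scale1r. Qed.
Fact vquot_scaleDr : right_distributive vquot_scale +%R.
Proof.
by move=> a p q; rewrite -[p]vreprK -[q]vreprK -raddfD -!vpiZ scalerDr raddfD.
Qed.
Fact vquot_scaleDl q : {morph vquot_scale^~ q : a b / a + b}.
Proof. by move=> a b; rewrite -[q]vreprK -!vpiZ scalerDl raddfD. Qed.

HB.instance Definition _ := GRing.Zmodule_isLmodule.Build K vquot
  vquot_scaleA vquot_scale1 vquot_scaleDr vquot_scaleDl.

Lemma vpi_is_scalable : scalable vpi. Proof. exact: vpiZ. Qed.
HB.instance Definition _ := GRing.isScalable.Build K V vquot _ vpi
  vpi_is_scalable.

Fact vquot_vect_iso : Vector.axiom (dim (subvs_of U^C)) vquot.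
Proof.
have dUc : (U^C :&: U = 0)%VS by rewrite capvC capv_compl.
have fullUc : (U^C + U)%VS = fullv by rewrite addvC addv_complf.
pose P x : V := daddv_pi U^C U x.
have Pmem x : P x \in U^C%VS by apply: memv_pi.
have Pmod x : x - P x \in U.
  have := daddv_pi_add dUc; rewrite fullUc => /(_ x (memvf x)) Ex.
  by rewrite -[X in X - _]Ex addrAC subrr add0r memv_pi.
have PU x : x \in U -> P x = 0.
  move=> xU; apply/eqP; rewrite -memv0 -dUc memv_cap Pmem /=.
  by rewrite -[P x](subKr x) rpredB ?Pmod.
pose f (q : vquot) := v2r (vsproj U^C (P (vrepr q))).
have fE x : f (vpi x) = v2r (vsproj U^C (P x)).
  congr (v2r (vsproj _ _)); apply/eqP; rewrite -subr_eq0 /P -linearB.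
  by apply/eqP/PU; rewrite -vpi_eq vreprK.
exists f.
  move=> a p q; rewrite -[p]vreprK -[q]vreprK -linearP !fE.
  by rewrite /P !linearP.
exists (fun r => vpi (vsval (r2v r))) => [q | r].
  rewrite -[q]vreprK fE v2rK vsprojK //; apply/eqP.
  by rewrite eq_sym vpi_eq.
rewrite fE; have -> : P (vsval (r2v r)) = vsval (r2v r).
  by apply: daddv_pi_id => //; apply: subvsP.
by rewrite vsvalK r2vK.
Qed.
HB.instance Definition _ := Lmodule_hasFinDim.Build K vquot vquot_vect_iso.

(* If f factors through V / U (resp. f factors through V / U x V' / U'), then *)
(* vquot_lift f (resp. vquot_lift2 f) is the induced map.                     *)
Definition vquot_lift (T : Type) (f : V -> T) (q : vquot) : T := f (vrepr q).

Lemma vquot_liftE (W : lmodType K) (f : {linear V -> W}) :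
  {in U, forall u, f u = 0} -> forall x, vquot_lift f (vpi x) = f x.
Proof.
move=> fU x; apply/eqP; rewrite -subr_eq0 -linearB fU //.
by rewrite -vpi_eq vreprK.
Qed.

End QuotientSpace.

Definition vquot_lift2 (K : fieldType) (V V' : vectType K) (U : {vspace V})
    (U' : {vspace V'}) (T : Type) (f : V -> V' -> T) (p : vquot U)
    (q : vquot U') : T :=
  vquot_lift (fun x => vquot_lift (f x) q) p.

Section DirectSum.
Variables (K : fieldType) (I : finType) (V : I -> vectType K).

Definition dsum : Type := {dffun forall i : I, V i}.

HB.instance Definition _ := Choice.on dsum.

Definition dsum_proj (x : dsum) (i : I) : V i := x i.
Definition dsum_mk (f : forall i, V i) : dsum := [ffun i => f i].

Lemma dsum_mkE f i : dsum_proj (dsum_mk f) i = f i.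
Proof. exact: ffunE. Qed.
Lemma dsumP (x y : dsum) : (forall i, dsum_proj x i = dsum_proj y i) <-> x = y.
Proof. exact: ffunP. Qed.

Let add (x y : dsum) := dsum_mk (fun i => dsum_proj x i + dsum_proj y i).
Let opp (x : dsum) := dsum_mk (fun i => - dsum_proj x i).
Let zero := dsum_mk (fun i => 0).
Let scale (a : K) (x : dsum) := dsum_mk (fun i => a *: dsum_proj x i).

Fact dsum_addA : associative add.
Proof. by move=> x y z; apply/dsumP => i; rewrite !dsum_mkE addrA. Qed.
Fact dsum_addC : commutative add.
Proof. by move=> x y; apply/dsumP => i; rewrite !dsum_mkE addrC. Qed.
Fact dsum_add0 : left_id zero add.
Proof. by move=> x; apply/dsumP => i; rewrite !dsum_mkE add0r. Qed.
Fact dsum_addN : left_inverse zero opp add.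
Proof. by move=> x; apply/dsumP => i; rewrite !dsum_mkE addNr. Qed.
HB.instance Definition _ :=
  GRing.isZmodule.Build dsum dsum_addA dsum_addC dsum_add0 dsum_addN.

Fact dsum_scaleA a b x : scale a (scale b x) = scale (a * b) x.
Proof. by apply/dsumP => i; rewrite !dsum_mkE scalerA. Qed.
Fact dsum_scale1 : left_id 1 scale.
Proof. by move=> x; apply/dsumP => i; rewrite !dsum_mkE scale1r. Qed.
Fact dsum_scaleDr : right_distributive scale +%R.
Proof. by move=> a x y; apply/dsumP => i; rewrite !dsum_mkE scalerDr. Qed.
Fact dsum_scaleDl x : {morph scale^~ x : a b / a + b}.
Proof. by move=> a b; apply/dsumP => i; rewrite !dsum_mkE scalerDl. Qed.
HB.instance Definition _ := GRing.Zmodule_isLmodule.Build K dsum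
  dsum_scaleA dsum_scale1 dsum_scaleDr dsum_scaleDl.

Fact dsum_proj_is_linear i : linear (dsum_proj^~ i).
Proof. by move=> a x y; rewrite !dsum_mkE. Qed.

Fact dsum_vect_iso : Vector.axiom #|{: {i : I & 'I_(dim (V i))}}| dsum.
Proof.
pose f (x : dsum) : 'rV_ #|{: {i : I & 'I_(dim (V i))}}| :=
  \row_k v2r (dsum_proj x (tag (enum_val k))) 0 (tagged (enum_val k)).
exists f.
  by move=> a x y; apply/rowP => k; rewrite !mxE !dsum_mkE !linearP !mxE.
exists (fun r : 'rV_ #|{: {i : I & 'I_(dim (V i))}}| => dsum_mk (fun i =>
   r2v (\row_j r 0 (enum_rank (Tagged (fun i => 'I_(dim (V i))) j))))).
  move=> x; apply/dsumP => i; rewrite dsum_mkE -[RHS]v2rK; congr r2v.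
  by apply/rowP => j; rewrite !mxE enum_rankK.
move=> r; apply/rowP => k; rewrite !mxE dsum_mkE r2vK mxE; congr (r 0 _).
by apply: (canLR enum_valK); case: (enum_val k).
Qed.
HB.instance Definition _ := Lmodule_hasFinDim.Build K dsum dsum_vect_iso.

Definition dsum_in (i : I) (v : V i) : dsum :=
  dsum_mk (dfwith (fun j => 0 : V j) v).

Lemma dsum_in_is_linear i : linear (@dsum_in i).
Proof.
move=> a u v; apply/dsumP => j; rewrite !dsum_mkE.
have [<-|ne_ij] := eqVneq i j; first by rewrite !dfwith_in.
by rewrite !dfwith_out // scaler0 addr0.
Qed.
HB.instance Definition _ i :=
  GRing.isLinear.Build K (V i) dsum _ (@dsum_in i) (@dsum_in_is_linear i).

Definition dsum_comp (i : I) : {vspace dsum} := limg (linfun (@dsum_in i)).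

End DirectSum.

(* U (x) V in coordinates: the matrix t represents the tensor                 *)
(* \sum_(i, j) t i j *: e_i (x) f_j, for the bases e of U and f of V chosen   *)
(* by vbasis.                                                                 *)
Section Tensor.
Variables (K : fieldType) (U V : vectType K).

Definition tensor := 'M[K]_(\dim {:U}, \dim {:V}).

Definition tens (u : U) (v : V) : tensor :=
  \matrix_(i, j) (coord (vbasis fullv) i u * coord (vbasis fullv) j v).

(* The linear map U (x) V -> W induced by a bilinear map b : U x V -> W.      *)
Definition tens_lift (W : lmodType K) (b : U -> V -> W) (t : tensor) : W :=
  \sum_i \sum_j t i j *: b (vbasis fullv)`_i (vbasis fullv)`_j.

Lemma tens_liftE (W : lmodType K) (b : U -> V -> W) :
  (forall u, linear (b u)) -> (forall v, linear (b^~ v)) ->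
  forall u v, tens_lift b (tens u v) = b u v.
Proof.
have sumb (X W' : lmodType K) (f : X -> W') n (a : 'I_n -> K) (x : 'I_n -> X) :
    linear f -> f (\sum_i a i *: x i) = \sum_i a i *: f (x i).
  move=> lf.
  pose F : {linear X -> W'} := HB.pack f (GRing.isLinear.Build _ _ _ _ f lf).
  rewrite -[f]/(F : X -> W') linear_sum.
  by apply: eq_bigr => i _; rewrite linearZ.
move=> bl br u v; rewrite {2}(coord_vbasis (memvf u)) (sumb _ _ (b^~ v)) //.
apply: eq_bigr => i _; rewrite {2}(coord_vbasis (memvf v)) sumb // scaler_sumr.
by apply: eq_bigr => j _; rewrite scalerA !mxE.
Qed.

End Tensor.

Section Separable.
Variables (K : fieldType) (C : falgType K).

(* a . (x (x) y) . b = (a x) (x) (y b) *)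
Definition tens_bimod (a b : C) : tensor C C -> tensor C C :=
  tens_lift (fun x y => tens (a * x) (y * b)).

Definition tens_mul : tensor C C -> C := tens_lift (fun x y => x * y).

(* C is separable over K when the multiplication C (x) C -> C has a section   *)
(* that is a morphism of C-bimodules.                                         *)
Definition separable_algebra : Prop :=
  exists s : C -> tensor C C,
    [/\ linear s,
        forall a b x, s (a * x * b) = tens_bimod a b (s x)
      & forall x, tens_mul (s x) = x].

End Separable.

Section CrossedAlgebra.
Variables (K : fieldType) (gT : finGroupType) (A : vectType K).

(* Trace of the restriction to U of a linear map f such that f(U) <= U.       *)
Definition vtrace (U : {vspace A}) (f : A -> A) : K :=
  \sum_(i < \dim U) coord (vbasis U) i (f (vbasis U)`_i).

(* The grading is by the subspaces Ag g; theta is a functional on Ag 1, and   *)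
(* only its values there are relevant.                                        *)
Record crossed_algebra (Ag : gT -> {vspace A}) (act : gT -> A -> A)
    (theta : A -> K) (mul : A -> A -> A) : Prop := CrossedAlgebra {
  ca_direct : directv (\sum_(g : gT) Ag g);
  ca_sum : (\sum_(g : gT) Ag g)%VS = fullv;

  ca_act_linear : forall g, linear (act g);
  ca_act1 : forall x, act 1%g x = x;
  ca_actM : forall g h x, act (g * h)%g x = act g (act h x);
  ca_act_comp : forall g h y,
    y \in Ag (g * h * g^-1)%g <-> exists2 x, x \in Ag h & y = act g x;
  ca_act_id : forall g, {in Ag g, forall x, act g x = x};

  ca_theta_linear : forall a,
    {in Ag 1%g &, forall x y, theta (a *: x + y) = a * theta x + theta y};
  ca_theta_act : forall g, {in Ag 1%g, forall x, theta (act g x) = theta x};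

  ca_mul_linearl : forall y, linear (mul^~ y);
  ca_mul_linearr : forall x, linear (mul x);
  ca_mulA : associative mul;

  ca_act_mul : forall g x y, act g (mul x y) = mul (act g x) (act g y);
  ca_mul_comp : forall g h x y,
    x \in Ag g -> y \in Ag h -> mul x y \in Ag (g * h)%g;
  ca_mulC : forall g h x y,
    x \in Ag g -> y \in Ag h -> mul x y = mul (act g y) x;
  ca_torus : forall g h c, c \in Ag (h * g * h^-1 * g^-1)%g ->
    vtrace (Ag h) (fun x => mul c (act g x)) =
    vtrace (Ag g) (fun x => act h^-1%g (mul c x));
  ca_unital : exists u, left_id u mul /\ right_id u mul;
  ca_nondeg : forall g,
    (forall x, x \in Ag g ->
       (forall y, y \in Ag g^-1%g -> theta (mul x y) = 0) -> x = 0) /\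
    (forall y, y \in Ag g^-1%g ->
       (forall x, x \in Ag g -> theta (mul x y) = 0) -> y = 0)
}.

End CrossedAlgebra.

Section TwistedFrobenius.
Variables (K : fieldType) (gT : finGroupType) (C : falgType K).

Record cat_action := CatAction {
  rho : gT -> {lrmorphism C -> C};
  cc : gT -> gT -> C;
  ce : C;
  rho_bij : forall g, bijective (rho g);
  cc_unit : forall g h, cc g h \is a GRing.unit;
  ce_unit : ce \is a GRing.unit;
  rhoM : forall g h x,
    rho g (rho h x) = cc g h * rho (g * h)%g x * (cc g h)^-1;
  rho1 : forall x, rho 1%g x = ce * x * ce^-1;
  cc_cocycle : forall g h k,
    cc g h * cc (g * h)%g k = rho g (cc h k) * cc g (h * k)%g;
  cc_g1 : forall g, cc g 1%g = rho g ce;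
  cc_1g : forall g, cc 1%g g = ce
}.

Record twisted_frobenius := TwistedFrobenius {
  tf_act :> cat_action;
  theta : {scalar C};
  thetaC : forall a b, theta (a * b) = theta (b * a);
  theta_nondeg : forall a, (forall b, theta (a * b) = 0) -> a = 0;
  theta_rho : forall g c, theta (rho tf_act g c) = theta c
}.

Definition inverse_tensor (F : twisted_frobenius) (xi : tensor C C) : Prop :=
  forall c, c = tens_lift (fun x' x'' => theta F (c * x'') *: x') xi.

Lemma inverse_tensor_exists F : exists xi, inverse_tensor F xi.
Proof.
pose n := \dim {:C}; pose e : n.-tuple C := vbasis fullv.
have coordE (x : C) : x = \sum_i coord e i x *: e`_i.
  exact: coord_vbasis (memvf x).
pose B : 'M[K]_n := \matrix_(i, j) theta F (e`_i * e`_j).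
pose r (c : C) := \row_i coord e i c.
have BE c j : (r c *m B) 0 j = theta F (c * e`_j).
  rewrite {2}[c]coordE mulr_suml linear_sum mxE; apply: eq_bigr => i _.
  by rewrite -scalerAl linearZ !mxE.
have Bu : B \in unitmx.
  rewrite -row_free_unit; apply/inj_row_free => v vB.
  pose c := \sum_i v 0 i *: e`_i.
  have rc : r c = v.
    apply/rowP => i; rewrite mxE coord_sum_free //.
    exact: basis_free (vbasisP _).
  suff c0 : c = 0 by rewrite -rc c0; apply/rowP => i; rewrite !mxE linear0.
  apply: (theta_nondeg (t := F)) => b; rewrite [b]coordE mulr_sumr linear_sum.
  by apply: big1 => j _; rewrite -scalerAr linearZ /= -BE rc vB mxE mulr0.
exists (invmx B)^T => c.
rewrite {1}[c]coordE; apply: eq_bigr => i _.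
have /rowP/(_ i) := mulmxK Bu (r c); rewrite [in RHS]mxE => <-.
rewrite mxE scaler_suml; apply: eq_bigr => j _.
by rewrite BE mxE scalerA mulrC.
Qed.

Section HochschildHomology.
Variable a : cat_action.

Definition hh_gen (h : gT) (c1 c2 : C) : C := c1 * c2 - c2 * rho a h c1.

(* By bilinearity of hh_gen it is enough to let c1, c2 range over a basis;    *)
(* see hh_sub_subP.                                                           *)
Definition hh_sub (h : gT) : {vspace C} :=
  <<[seq hh_gen h c1 c2 | c1 <- vbasis fullv, c2 <- vbasis fullv]>>%VS.

Lemma hh_sub_subP h (U : {vspace C}) :
  (hh_sub h <= U)%VS <-> forall c1 c2, hh_gen h c1 c2 \in U.
Proof.
split=> [sU c1 c2 | gU]; last first.
  by apply/span_subvP => _ /allpairsP[[c1 c2] [_ _ ->]].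
rewrite (coord_vbasis (memvf c1)) (coord_vbasis (memvf c2)).
rewrite /hh_gen linear_sum mulr_suml mulr_sumr -sumrB; apply: rpred_sum => i _.
rewrite mulr_sumr mulr_suml -sumrB; apply: rpred_sum => j _.
rewrite linearZ -!scalerAl -!scalerAr /= !scalerA [X in _ - X *: _]mulrC.
rewrite -scalerBr rpredZ //; apply: (subvP sU); apply: memv_span.
by apply/allpairsP; exists ((vbasis fullv)`_i, (vbasis fullv)`_j);
  rewrite !mem_nth ?size_tuple.
Qed.

Definition hh (h : gT) : vectType K := vquot (hh_sub h).
Definition hh_total : vectType K := dsum hh.

Definition hh_T (h g : gT) (c : C) : C :=
  (ce a)^-1 * (cc a g g^-1%g)^-1 * rho a g c * cc a g h * cc a (g * h)%g g^-1%g.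

Definition hh_act_comp (h g : gT) : hh h -> hh (g * h * g^-1)%g :=
  vquot_lift (fun c => vpi (hh_sub (g * h * g^-1)%g) (hh_T h g c)).

Definition hh_act (g : gT) (x : hh_total) : hh_total :=
  \sum_(h : gT) dsum_in (hh_act_comp g (dsum_proj x h)).

Definition hh_m (xi : tensor C C) (g h : gT) (c' c'' : C) : C :=
  tens_lift (fun x' x'' => x' * c' * rho a g (x'' * c'') * cc a g h) xi.

Definition hh_mul_comp (xi : tensor C C) (g h : gT) :
    hh g -> hh h -> hh (g * h)%g :=
  vquot_lift2 (fun c' c'' => vpi (hh_sub (g * h)%g) (hh_m xi g h c' c'')).

Definition hh_mul (xi : tensor C C) (x y : hh_total) : hh_total :=
  \sum_(g : gT) \sum_(h : gT)
    dsum_in (hh_mul_comp xi (dsum_proj x g) (dsum_proj y h)).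

End HochschildHomology.

Definition hh_theta_e (F : twisted_frobenius) : hh F 1%g -> K :=
  vquot_lift (fun c => theta F (c * ce F)).

Definition hh_theta (F : twisted_frobenius) (x : hh_total F) : K :=
  hh_theta_e (dsum_proj x 1%g).

End TwistedFrobenius.

(* Main.v *)
Require Import Defs.
From HB Require Import structures.
From mathcomp Require Import all_boot all_order all_fingroup all_algebra.
From mathcomp Require Import falgebra.

(* Let A = (+)_g C u_g be the crossed product, with u_g c = g(c) u_g and
   u_g u_h = c_{g,h} u_{gh}. Then HH_0(C)_h = A_h / [C, A_h], the operator T(g)
   is conjugation by u_g, and the product of the classes of a and b is the class
   of tau(a) b, where tau(a) = \sum_i xi_i' a xi_i''. The map tau takes values in
   the centralizer Z of C in A and kills [C, A]. Separability provides t in C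
   with tau(t) = 1, and then z |-> [t z] is inverse to the map induced by tau. So
   HH_0(C) is Z with its algebra structure and the action by conjugation, where
   all axioms but the torus axiom are direct. The two traces of the torus axiom
   are computed with dual bases of A_h and A_g for the trace form of A, and
   agree by moving the two copies of xi past each other. *)

Set Implicit Arguments.
Unset Strict Implicit.
Unset Printing Implicit Defensive.

Import GRing.Theory.
Local Open Scope ring_scope.

(** * The crossed product *)

Section CrossedProduct.
Variables (K : fieldType) (gT : finGroupType) (C : falgType K).
Variable a : cat_action gT C.

Definition crossed_prod of cat_action gT C : Type := {ffun gT -> C}.

HB.instance Definition _ := Vector.on (crossed_prod a).

Implicit Types (x y z : crossed_prod a) (g h k : gT) (b c d : C).

(** A function [x] stands for the sum of the [x g] u_g, with coefficients on the left. *)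
Definition cp_mul x y : crossed_prod a :=
  [ffun k => \sum_g x g * rho a g (y (g^-1 * k)%g) * cc a g (g^-1 * k)%g].
Definition cp_mono g c : crossed_prod a := [ffun k => if k == g then c else 0].
(** The symbol u_1 is identified with c_e and not with the unit; hence the factor c_e^-1 here and in
    [cp_base]. *)
Definition cp_one := cp_mono 1%g (ce a)^-1.

Lemma cp_monoE g c k : cp_mono g c k = if k == g then c else 0.
Proof. exact: ffunE. Qed.

Lemma cp_addE x y k : (x + y) k = x k + y k. Proof. exact: ffunE. Qed.

Lemma rho1_cc1 c g : (ce a)^-1 * rho a 1%g c * cc a 1%g g = c.
Proof. by rewrite rho1 cc_1g !mulrA mulVr ?ce_unit // mul1r divrK ?ce_unit. Qed.

Fact cp_mulA : associative cp_mul.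
Proof.
move=> x y z; apply/ffunP => k; rewrite !ffunE.
under [RHS]eq_bigr => p _ do rewrite !ffunE !mulr_suml.
rewrite exchange_big; apply: eq_bigr => g _ /=.
rewrite ffunE rmorph_sum mulr_sumr mulr_suml.
rewrite [RHS](reindex_inj (mulgI g)); apply: eq_bigr => h _ /=.
rewrite !rmorphM /= mulKg rhoM invMg -!mulgA.
set l := (h^-1 * (g^-1 * k))%g; have -> : (g^-1 * k = h * l)%g by rewrite mulKVg.
rewrite -!mulrA; congr (_ * (_ * (_ * _))).
(* The two triple products now differ only by the cocycle identity. *)
by rewrite -cc_cocycle mulKr ?cc_unit.
Qed.

Fact cp_mul1 : left_id cp_one cp_mul.
Proof.
move=> x; apply/ffunP => k; rewrite ffunE (bigD1 1%g) //= big1 => [|g /negPf g1].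
  by rewrite cp_monoE eqxx addr0 rho1_cc1 invg1 mul1g.
by rewrite cp_monoE g1 !mul0r.
Qed.

Fact cp_mulr1 : right_id cp_one cp_mul.
Proof.
move=> x; apply/ffunP => k; rewrite ffunE (bigD1 k) //= big1 => [|g gk].
  rewrite cp_monoE mulVg eqxx addr0 cc_g1 -mulrA -rmorphM mulVr ?ce_unit //.
  by rewrite rmorph1 mulr1.
by rewrite cp_monoE -eq_mulVg1 (negPf gk) rmorph0 mulr0 mul0r.
Qed.

Fact cp_mulDl : left_distributive cp_mul +%R.
Proof.
move=> x y z; apply/ffunP => k; rewrite cp_addE !ffunE -big_split.
by apply: eq_bigr => g _; rewrite cp_addE !mulrDl.
Qed.

Fact cp_mulDr : right_distributive cp_mul +%R.
Proof.
move=> x y z; apply/ffunP => k; rewrite cp_addE !ffunE -big_split.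
by apply: eq_bigr => g _; rewrite cp_addE rmorphD mulrDr mulrDl.
Qed.

HB.instance Definition _ := GRing.Zmodule_isPzRing.Build (crossed_prod a)
  cp_mulA cp_mul1 cp_mulr1 cp_mulDl cp_mulDr.

Lemma cp_mulE x y k :
  (x * y) k = \sum_g x g * rho a g (y (g^-1 * k)%g) * cc a g (g^-1 * k)%g.
Proof. exact: ffunE. Qed.

Lemma cp_scaleE (l : K) x k : (l *: x) k = l *: x k.
Proof. exact: ffunE. Qed.

Lemma cp_sumE (I : Type) (r : seq I) (P : pred I) (f : I -> crossed_prod a) k :
  (\sum_(i <- r | P i) f i) k = \sum_(i <- r | P i) f i k.
Proof. by apply: (big_morph (fun x => x k)) => [x y|]; rewrite ffunE. Qed.

Fact cp_scaleAl (l : K) x y : l *: (x * y) = l *: x * y.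
Proof.
apply/ffunP => k; rewrite cp_scaleE !cp_mulE scaler_sumr; apply: eq_bigr => g _.
by rewrite cp_scaleE -!scalerAl.
Qed.

Fact cp_scaleAr (l : K) x y : l *: (x * y) = x * (l *: y).
Proof.
apply/ffunP => k; rewrite cp_scaleE !cp_mulE scaler_sumr; apply: eq_bigr => g _.
by rewrite cp_scaleE linearZ /= -scalerAr -scalerAl.
Qed.

Lemma cp_mono_linear g : linear (cp_mono g).
Proof.
move=> l b c; apply/ffunP => k; rewrite cp_addE cp_scaleE !cp_monoE.
by case: eqP => // _; rewrite scaler0 addr0.
Qed.
HB.instance Definition _ g := GRing.isLinear.Build K C (crossed_prod a) _ (cp_mono g)
  (cp_mono_linear g).

Lemma cp_sum_mono x : x = \sum_g cp_mono g (x g).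
Proof.
apply/ffunP => k; rewrite cp_sumE (bigD1 k) //= big1 => [|g /negPf gk].
  by rewrite cp_monoE eqxx addr0.
by rewrite cp_monoE eq_sym gk.
Qed.

Lemma cp_monoM g h c d :
  cp_mono g c * cp_mono h d = cp_mono (g * h)%g (c * rho a g d * cc a g h).
Proof.
apply/ffunP => k; rewrite cp_mulE cp_monoE (bigD1 g) //= big1 => [|p /negPf pg].
  rewrite !cp_monoE eqxx addr0 -(inj_eq (mulgI g)) mulKVg.
  by case: eqP => [->|_]; rewrite ?mulKg // rmorph0 mulr0 mul0r.
by rewrite cp_monoE pg !mul0r.
Qed.

Definition cp_base c : crossed_prod a := cp_mono 1%g (c * (ce a)^-1).

Lemma cp_base_linear : linear cp_base.
Proof. by move=> l b c; rewrite /cp_base mulrDl -scalerAl linearP. Qed.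
HB.instance Definition _ := GRing.isLinear.Build K C (crossed_prod a) _ cp_base
  cp_base_linear.

Lemma cp_base1 : cp_base 1 = 1.
Proof. by rewrite /cp_base mul1r. Qed.

Lemma cp_base_mono c g d : cp_base c * cp_mono g d = cp_mono g (c * d).
Proof. by rewrite cp_monoM mul1g -!mulrA (mulrA _^-1) rho1_cc1. Qed.

Lemma cp_mono_base c g d : cp_mono g c * cp_base d = cp_mono g (c * rho a g d).
Proof.
rewrite cp_monoM mulg1 cc_g1 rmorphM -!mulrA -rmorphM mulVr ?ce_unit //.
by rewrite rmorph1 mulr1.
Qed.

Lemma cp_baseM c d : cp_base (c * d) = cp_base c * cp_base d.
Proof. by rewrite [cp_base d]/cp_base cp_base_mono mulrA. Qed.

(** * The units u_g and their inverses *)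

Definition cp_u g : crossed_prod a := cp_mono g 1.
(** Since u_g u_{g^-1} = c_{g,g^-1} c_e, this is a right inverse of u_g. Its factor from C is the
    one that opens [hh_T], but stands on the other side. *)
Definition cp_uV g : crossed_prod a :=
  locked (cp_mono g^-1%g 1 * cp_base ((ce a)^-1 * (cc a g g^-1%g)^-1)).

Lemma cp_uM g h : cp_u g * cp_u h = cp_base (cc a g h) * cp_u (g * h)%g.
Proof. by rewrite cp_monoM cp_base_mono rmorph1 !(mulr1, mul1r). Qed.

Lemma cp_u_base g c : cp_u g * cp_base c = cp_base (rho a g c) * cp_u g.
Proof. by rewrite cp_mono_base cp_base_mono mulr1 mul1r. Qed.

Lemma cp_u1 : cp_u 1%g = cp_base (ce a).
Proof. by rewrite /cp_base divrr ?ce_unit. Qed.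

Lemma cp_mono_u g c : cp_mono g c = cp_base c * cp_u g.
Proof. by rewrite cp_base_mono mulr1. Qed.

Lemma cp_umuV g : cp_u g * cp_uV g = 1.
Proof.
rewrite /cp_uV -lock mulrA cp_uM mulgV cp_u1 -!cp_baseM mulrA -(mulrA (cc a g _)).
by rewrite divrr ?ce_unit // mulr1 divrr ?cc_unit // cp_base1.
Qed.

(* [cp_u g] has a left inverse as well, since [cp_u g^-1 * cp_u g] is a unit of
   the base algebra. *)
Lemma cp_uVmu g : cp_uV g * cp_u g = 1.
Proof.
have ub c : c \is a GRing.unit -> cp_base c^-1 * cp_base c = 1.
  by move=> cU; rewrite -cp_baseM mulVr // cp_base1.
have [v uv] : exists v, v * cp_u g = 1.
  exists (cp_base (ce a)^-1 * (cp_base (cc a g^-1 g)%g^-1 * cp_u g^-1)).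
  rewrite -!mulrA cp_uM mulVg cp_u1 (mulrA _ (cp_base (cc _ _ _))).
  by rewrite ub ?cc_unit // mul1r ub ?ce_unit.
have -> // : cp_uV g = v by rewrite -[LHS]mul1r -uv -mulrA cp_umuV mulr1.
Qed.

Lemma cp_base_uV g c : cp_base c * cp_uV g = cp_uV g * cp_base (rho a g c).
Proof.
by rewrite -[LHS]mul1r -(cp_uVmu g) -!mulrA (mulrA (cp_u g)) cp_u_base -!mulrA
  cp_umuV mulr1.
Qed.

Lemma cp_base_mulE c x k : (cp_base c * x) k = c * x k.
Proof.
rewrite [x in LHS]cp_sum_mono mulr_sumr cp_sumE (bigD1 k) //= big1 => [|g /negPf gk].
  by rewrite cp_base_mono cp_monoE eqxx addr0.
by rewrite cp_base_mono cp_monoE eq_sym gk.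
Qed.

Lemma cp_mul_baseE c x k : (x * cp_base c) k = x k * rho a k c.
Proof.
rewrite [x in LHS]cp_sum_mono mulr_suml cp_sumE (bigD1 k) //= big1 => [|g /negPf gk].
  by rewrite cp_mono_base cp_monoE eqxx addr0.
by rewrite cp_mono_base cp_monoE eq_sym gk.
Qed.

Definition cp_deg g x := x = cp_mono g (x g).

Lemma cp_deg_mono g c : cp_deg g (cp_mono g c).
Proof. by rewrite /cp_deg cp_monoE eqxx. Qed.

Lemma cp_degM g h x y : cp_deg g x -> cp_deg h y -> cp_deg (g * h)%g (x * y).
Proof. by move=> -> ->; rewrite cp_monoM; apply: cp_deg_mono. Qed.

Lemma cp_deg_sum (I : Type) (r : seq I) (f : I -> crossed_prod a) g :
  (forall i, cp_deg g (f i)) -> cp_deg g (\sum_(i <- r) f i).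
Proof.
move=> fg; rewrite /cp_deg cp_sumE linear_sum; apply: eq_bigr => i _; exact: fg.
Qed.

Lemma cp_deg_base c : cp_deg 1%g (cp_base c). Proof. exact: cp_deg_mono. Qed.
Lemma cp_deg_u g : cp_deg g (cp_u g). Proof. exact: cp_deg_mono. Qed.
Lemma cp_deg_uV g : cp_deg g^-1%g (cp_uV g).
Proof.
rewrite /cp_uV -lock -[X in cp_deg X]mulg1.
exact: cp_degM (cp_deg_mono _ _) (cp_deg_base _).
Qed.

End CrossedProduct.

(** * The Casimir element *)

Lemma linear_fun_sum (K : fieldType) (V W : lmodType K) (f : V -> W) (I : Type)
    (r : seq I) (P : pred I) (l : I -> K) (v : I -> V) :
  linear f ->
  f (\sum_(i <- r | P i) l i *: v i) = \sum_(i <- r | P i) l i *: f (v i).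
Proof.
move=> lf; pose F : {linear V -> W} := HB.pack f (GRing.isLinear.Build _ _ _ _ f lf).
by rewrite -[f]/(F : V -> W) linear_sum; apply: eq_bigr => i _; rewrite linearZ.
Qed.

Section TensLift.
Variables (K : fieldType) (U V : vectType K).

Lemma tens_lift_linear (W : lmodType K) (b : U -> V -> W) :
  linear (tens_lift b).
Proof.
move=> l s t; rewrite /tens_lift scaler_sumr -big_split; apply: eq_bigr => i _.
rewrite scaler_sumr -big_split; apply: eq_bigr => j _.
by rewrite !mxE scalerDl scalerA.
Qed.

Lemma eq_tens_lift (W : lmodType K) (b b' : U -> V -> W) t :
  (forall x y, b x y = b' x y) -> tens_lift b t = tens_lift b' t.
Proof. by move=> bb'; do 2!apply: eq_bigr => ? _; rewrite bb'. Qed.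

Lemma linear_tens_lift (W X : lmodType K) (b : U -> V -> W) (f : W -> X) t :
  linear f -> f (tens_lift b t) = tens_lift (fun x y => f (b x y)) t.
Proof.
move=> lf; have f1 v : f v = f (1 *: v) by rewrite scale1r.
rewrite /tens_lift (eq_bigr _ (fun i _ => esym (scale1r _))) linear_fun_sum //.
by apply: eq_bigr => i _; rewrite scale1r linear_fun_sum.
Qed.

Lemma sum_tens_lift (W : lmodType K) (I : Type) (r : seq I)
    (b : I -> U -> V -> W) t :
  \sum_(i <- r) tens_lift (b i) t =
    tens_lift (fun x y => \sum_(i <- r) b i x y) t.
Proof.
rewrite exchange_big; apply: eq_bigr => i _; rewrite exchange_big.
by apply: eq_bigr => j _; rewrite scaler_sumr.
Qed.

End TensLift.

Lemma tens_lift_bimod (K : fieldType) (C : falgType K) (W : lmodType K)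
    (B : C -> C -> W) (c d : C) t :
  (forall x, linear (B x)) -> (forall y, linear (B^~ y)) ->
  tens_lift B (tens_bimod c d t) = tens_lift (fun x y => B (c * x) (y * d)) t.
Proof.
move=> Br Bl; rewrite /tens_bimod /tens_lift -/(tens_lift B _).
pose F : {linear _ -> _} :=
  HB.pack (tens_lift B) (GRing.isLinear.Build _ _ _ _ _ (tens_lift_linear B)).
rewrite -[tens_lift B]/(F : _ -> _) linear_sum; apply: eq_bigr => i _.
by rewrite linear_sum; apply: eq_bigr => j _; rewrite linearZ /= tens_liftE.
Qed.

Section Casimir.
Variables (K : fieldType) (gT : finGroupType) (C : falgType K).
Variables (F : twisted_frobenius gT C) (xi : tensor C C).
Hypothesis xiP : inverse_tensor F xi.

Local Notation n := (\dim {:C}).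

(* [xi = \sum_j casl j (x) casr j] *)
Definition casl (j : 'I_n) : C := locked (\sum_i xi i j *: (vbasis fullv)`_i).
Definition casr (j : 'I_n) : C := (vbasis fullv)`_j.

Lemma casimirE (W : lmodType K) (B : C -> C -> W) :
  (forall y, linear (B^~ y)) -> tens_lift B xi = \sum_j B (casl j) (casr j).
Proof.
move=> Bl; rewrite /tens_lift exchange_big; apply: eq_bigr => j _.
by rewrite /casl -lock (linear_fun_sum _ _ _ _ (Bl _)).
Qed.

Lemma casl_dual c : c = \sum_j theta F (c * casr j) *: casl j.
Proof.
rewrite {1}[c](xiP c) (casimirE (B := fun x y => theta F (c * y) *: x)) //.
by move=> y l u v; rewrite scalerDr !scalerA mulrC.
Qed.

Lemma theta_inj c d : (forall b, theta F (c * b) = theta F (d * b)) -> c = d.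
Proof.
move=> cd; apply/eqP; rewrite -subr_eq0; apply/eqP.
by apply: (theta_nondeg (t := F)) => b; rewrite mulrBl linearB /= cd subrr.
Qed.

(** By [casl_dual] and the trace property, both sides pair equally with every [b]. *)
Lemma casr_dual c : c = \sum_j theta F (c * casl j) *: casr j.
Proof.
apply: theta_inj => b; rewrite {1}[b]casl_dual mulr_sumr mulr_suml !linear_sum.
apply: eq_bigr => j _.
by rewrite -scalerAl -scalerAr !linearZ /= mulrC (thetaC F b).
Qed.

Section Bilinear.
Variables (W : lmodType K) (B : C -> C -> W).
Hypotheses (Br : forall x, linear (B x)) (Bl : forall y, linear (B^~ y)).

(** Expanding the second leg by [casl_dual] gives coefficients [theta F (casr j * casr k)], which
    are symmetric in j and k. *)
Lemma casimir_sym :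
  \sum_j B (casl j) (casr j) = \sum_j B (casr j) (casl j).
Proof.
transitivity (\sum_j \sum_k theta F (casr j * casr k) *: B (casl j) (casl k)).
  by apply: eq_bigr => j _; rewrite {1}[casr j]casl_dual linear_fun_sum.
rewrite exchange_big; apply: eq_bigr => k _ /=.
rewrite {2}[casr k]casl_dual (linear_fun_sum _ _ _ _ (Bl _)).
by apply: eq_bigr => j _; rewrite thetaC.
Qed.

(** The coefficients of [f (casl j)] along the left legs are, by adjointness, those of [f' (casr k)]
    along the right legs. *)
Lemma casimir_adj (f f' : C -> C) :
  (forall c d, theta F (f c * d) = theta F (c * f' d)) -> linear f' ->
  \sum_j B (f (casl j)) (casr j) = \sum_j B (casl j) (f' (casr j)).
Proof.
move=> ff' lf'.
transitivity (\sum_j \sum_k theta F (f (casl j) * casr k) *: B (casl k) (casr j)).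
  by apply: eq_bigr => j _; rewrite {1}[f _]casl_dual (linear_fun_sum _ _ _ _ (Bl _)).
rewrite exchange_big; apply: eq_bigr => k _ /=.
rewrite -linear_fun_sum //; congr (B _ _); rewrite [RHS]casr_dual.
by apply: eq_bigr => j _; rewrite ff' thetaC.
Qed.

End Bilinear.

(* If [\sum s' (x) s''] is the separability idempotent, then
   [t = \sum theta(s'') s']. *)
Lemma separable_casimir : separable_algebra C ->
  exists t, \sum_j casl j * t * casr j = 1.
Proof.
case=> s [ls sM s1]; set S := s 1.
(* Acting by [c] on either side of [S] gives [s c], as [s] is a bimodule map. *)
have bal (W : lmodType K) (B : C -> C -> W) c :
    (forall x, linear (B x)) -> (forall y, linear (B^~ y)) ->
  tens_lift (fun x y => B (c * x) y) S = tens_lift (fun x y => B x (y * c)) S.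
  move=> Br Bl.
  have : tens_bimod c 1 S = tens_bimod 1 c S by rewrite -!sM !mulr1 mul1r.
  move/(congr1 (tens_lift B)); rewrite !tens_lift_bimod //.
  under eq_tens_lift => x y do rewrite mulr1.
  by under [RHS]eq_tens_lift => x y do rewrite mul1r.
have lmul j : linear (fun z => casl j * z * casr j).
  by move=> l u v; rewrite mulrDr mulrDl -scalerAr -scalerAl.
exists (tens_lift (fun x y => theta F y *: x) S).
transitivity (\sum_j tens_lift (fun x y => theta F (y * casl j) *: (x * casr j)) S).
  apply: eq_bigr => j _; rewrite (linear_tens_lift _ _ (lmul j)).
  rewrite -(bal _ (fun x y => theta F y *: (x * casr j))).
  - by apply: eq_tens_lift => x y; rewrite -scalerAr -scalerAl.
  - by move=> x l u v; rewrite linearP scalerDl scalerA.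
  - by move=> y l u v; rewrite mulrDl -scalerAl scalerDr !scalerA mulrC.
(* By [casr_dual] the sum over j rebuilds [y], and [x * y] summed over [S] is 1. *)
rewrite sum_tens_lift -[RHS]s1; apply: eq_tens_lift => x y.
rewrite {2}[y]casr_dual mulr_sumr; apply: eq_bigr => j _.
by rewrite scalerAr.
Qed.
End Casimir.

(** * Casimir averaging in the crossed product *)

(** The family [x] may be longer than a basis of [U]; it only has to reproduce [U] through [phi].
    Expand the basis vectors in [x], exchange the sums, and collect the coordinates of each
    [f (x i)]. *)
Lemma vtrace_dual (K : fieldType) (A : vectType K) (U : {vspace A}) (f : A -> A)
    (I : finType) (x : I -> A) (phi : I -> A -> K) :
  linear f -> (forall i, scalar (phi i)) -> (forall i, f (x i) \in U) ->
  (forall u, u \in U -> u = \sum_i phi i u *: x i) ->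
  vtrace U f = \sum_i phi i (f (x i)).
Proof.
move=> lf lphi fU xE.
transitivity (\sum_(j < \dim U) \sum_i
    phi i (vbasis U)`_j * coord (vbasis U) j (f (x i))).
  apply: eq_bigr => j _.
  rewrite {1}[(vbasis U)`_j in LHS]xE ?vbasis_mem ?mem_nth ?size_tuple //.
  rewrite linear_fun_sum // linear_sum; apply: eq_bigr => i _.
  by rewrite linearZ.
rewrite exchange_big; apply: eq_bigr => i _ /=.
rewrite [in RHS](coord_vbasis (fU i)) (linear_fun_sum (W := K^o)) //.
by apply: eq_bigr => j _; rewrite mulrC.
Qed.

Section Trace.
Variables (K : fieldType) (gT : finGroupType) (C : falgType K).
Variables (F : twisted_frobenius gT C) (xi : tensor C C).
Hypothesis xiP : inverse_tensor F xi.
Local Notation A := (crossed_prod F).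
Local Notation "''b' c" := (cp_base F c) (at level 8, c at level 2).
Local Notation u := (cp_u F).
Local Notation uV := (cp_uV F).
Local Notation xl := (casl xi).
Local Notation xr := (@casr K C).
Implicit Types (x y z : A) (g h k : gT) (b c d : C).

(** As u_1 = c_e, the component of [x] in the copy of C is [x 1 * ce]. *)
Definition cp_theta x : K := theta F (x 1%g * ce F).

Lemma cp_theta_linear : scalar cp_theta.
Proof.
move=> l x y; rewrite /cp_theta cp_addE cp_scaleE mulrDl -scalerAl.
by rewrite linearD linearZ.
Qed.
HB.instance Definition _ := GRing.isLinear.Build K A K^o _ cp_theta
  cp_theta_linear.

Lemma cp_theta_base c : cp_theta 'b c = theta F c.
Proof. by rewrite /cp_theta cp_monoE eqxx divrK ?ce_unit. Qed.

(** The term of [x * y] at g is matched with that of [y * x] at g^-1, after applying [rho g] to the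
    latter, which preserves [theta]. *)
Lemma cp_thetaC x y : cp_theta (x * y) = cp_theta (y * x).
Proof.
rewrite /cp_theta !cp_mulE !mulr_suml !linear_sum [RHS](reindex_inj invg_inj).
apply: eq_bigr => g _; rewrite !mulg1 invgK /= -[RHS](theta_rho F g).
rewrite !rmorphM /= rhoM mulgV rho1 -!mulrA thetaC -!mulrA; congr (theta F _).
(* This is the cocycle identity at (g, g^-1, g). *)
have E : cc F g g^-1%g * ce F = rho F g (cc F g^-1%g g) * rho F g (ce F).
  by have := cc_cocycle F g g^-1 g; rewrite mulgV mulVg cc_1g cc_g1.
rewrite -{}E !mulrA -(mulrA _ (cc F _ _)^-1) mulVr ?cc_unit // mulr1.
by rewrite divrK ?ce_unit.
Qed.

Lemma cp_theta_conj g x : cp_theta (u g * x * uV g) = cp_theta x.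
Proof. by rewrite cp_thetaC mulrA cp_uVmu mul1r. Qed.

Definition cp_tau x : A := \sum_j 'b (xl j) * x * 'b (xr j).

Lemma cp_tau_linear : linear cp_tau.
Proof.
move=> l x y; rewrite /cp_tau scaler_sumr -big_split; apply: eq_bigr => j _ /=.
by rewrite mulrDr mulrDl cp_scaleAl cp_scaleAr.
Qed.
HB.instance Definition _ := GRing.isLinear.Build K A A _ cp_tau cp_tau_linear.

(** * Moving factors across the Casimir element inside A *)

Section Sandwich.
Variables (L : A -> A).
Hypothesis lL : linear L.

Lemma sandwich_linearr c : linear (fun d => 'b c * L 'b d).
Proof. by move=> l x y; rewrite linearP lL mulrDr cp_scaleAr. Qed.

Lemma sandwich_linearl d : linear (fun c => 'b c * L 'b d).
Proof. by move=> l x y; rewrite linearP mulrDl cp_scaleAl. Qed.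

Lemma sandwich_sym :
  \sum_j 'b (xl j) * L 'b (xr j) = \sum_j 'b (xr j) * L 'b (xl j).
Proof.
exact: (casimir_sym xiP sandwich_linearr sandwich_linearl).
Qed.

Lemma sandwich_adj (f f' : C -> C) :
    (forall c d, theta F (f c * d) = theta F (c * f' d)) -> linear f' ->
  \sum_j 'b (f (xl j)) * L 'b (xr j) = \sum_j 'b (xl j) * L 'b (f' (xr j)).
Proof. exact: (casimir_adj xiP sandwich_linearr sandwich_linearl). Qed.

(** By the trace property, left and right multiplication by [c] are adjoint. *)
Lemma sandwich_mull c :
  \sum_j 'b c * 'b (xl j) * L 'b (xr j) = \sum_j 'b (xl j) * L ('b (xr j) * 'b c).
Proof.
under eq_bigr => j _ do rewrite -cp_baseM.
under [RHS]eq_bigr => j _ do rewrite -cp_baseM.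
have adj (x y : C) : theta F (c * x * y) = theta F (x * (y * c)).
  by rewrite -mulrA thetaC mulrA.
apply: (sandwich_adj adj) => l x y.
by rewrite mulrDl scalerAl.
Qed.

Lemma sandwich_mulr c :
  \sum_j 'b (xl j) * 'b c * L 'b (xr j) = \sum_j 'b (xl j) * L ('b c * 'b (xr j)).
Proof.
under eq_bigr => j _ do rewrite -cp_baseM.
under [RHS]eq_bigr => j _ do rewrite -cp_baseM.
have adj (x y : C) : theta F (x * c * y) = theta F (x * (c * y)) by rewrite mulrA.
apply: (sandwich_adj adj) => l x y.
by rewrite mulrDr scalerAr.
Qed.

End Sandwich.

(** As [theta] is invariant, the adjoint of [rho g] is its inverse, which in A is conjugation by
    u_g^-1. *)
Lemma sandwich_u (L : A -> A) g : linear L ->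
  \sum_j u g * 'b (xl j) * L 'b (xr j) =
  \sum_j 'b (xl j) * u g * L (uV g * 'b (xr j) * u g).
Proof.
move=> lL; have [r rK Kr] := rho_bij F g.
have lr : linear r by move=> l c d; apply: (can_inj rK); rewrite linearP /= !Kr.
have rE c : 'b (r c) = uV g * 'b c * u g.
  by rewrite -mulrA -{2}[c]Kr -cp_u_base mulrA cp_uVmu mul1r.
have lL' : linear (fun z => u g * L z).
  by move=> l x y; rewrite lL mulrDr cp_scaleAr.
under eq_bigr => j _ do rewrite cp_u_base -mulrA.
have adj c d : theta F (rho F g c * d) = theta F (c * r d).
  by rewrite -[in LHS](Kr d) -rmorphM theta_rho.
rewrite (sandwich_adj lL' adj lr).
by apply: eq_bigr => j _; rewrite rE mulrA.
Qed.

Lemma linear_mulr_mul x y : linear (fun z => x * z * y).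
Proof. by move=> l v w; rewrite mulrDr mulrDl cp_scaleAl cp_scaleAr. Qed.

Lemma linear_mulr x : linear ( *%R x).
Proof. by move=> l v w; rewrite mulrDr cp_scaleAr. Qed.

(** * The centralizer of C and the averaging map *)

Definition cp_cent z := forall c, 'b c * z = z * 'b c.

Lemma cp_tau_baseC c x : cp_tau ('b c * x) = cp_tau (x * 'b c).
Proof.
transitivity (\sum_j 'b (xl j) * 'b c * (x * 'b (xr j))).
  by apply: eq_bigr => j _; rewrite !mulrA.
rewrite (sandwich_mulr (linear_mulr x)).
by apply: eq_bigr => j _; rewrite !mulrA.
Qed.

Lemma cp_tau_cent x : cp_cent (cp_tau x).
Proof.
move=> c; rewrite /cp_tau mulr_sumr mulr_suml.
transitivity (\sum_j 'b c * 'b (xl j) * (x * 'b (xr j))).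
  by apply: eq_bigr => j _; rewrite !mulrA.
rewrite (sandwich_mull (linear_mulr x)).
by apply: eq_bigr => j _; rewrite !mulrA.
Qed.

Lemma cp_tauMl z x : cp_cent z -> cp_tau (z * x) = z * cp_tau x.
Proof.
by move=> zC; rewrite mulr_sumr; apply: eq_bigr => j _; rewrite mulrA zC !mulrA.
Qed.

Lemma cp_tauMr z x : cp_cent z -> cp_tau (x * z) = cp_tau x * z.
Proof.
by move=> zC; rewrite mulr_suml; apply: eq_bigr => j _; rewrite -!mulrA -zC.
Qed.

(** Conjugation by u_g acts on the legs of xi through [rho g], under which xi is invariant. *)
Lemma cp_tau_conj g x : cp_tau (u g * x * uV g) = u g * cp_tau x * uV g.
Proof.
transitivity (\sum_j u g * 'b (xl j) * (x * 'b (xr j) * uV g)); last first.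
  by rewrite mulr_sumr mulr_suml; apply: eq_bigr => j _; rewrite !mulrA.
rewrite (sandwich_u _ (linear_mulr_mul x (uV g))).
apply: eq_bigr => j _; rewrite -!mulrA; congr (_ * (_ * (_ * (_ * _)))).
by rewrite cp_umuV mulr1.
Qed.

(** Self-adjointness of [tau] combines the symmetry of xi with the trace property. *)
Lemma cp_theta_tau x y : cp_theta (cp_tau x * y) = cp_theta (x * cp_tau y).
Proof.
rewrite {2}/cp_tau; under [in RHS]eq_bigr => j _ do rewrite -mulrA.
rewrite (sandwich_sym (linear_mulr y)) mulr_suml mulr_sumr !linear_sum.
by apply: eq_bigr => j _ /=; rewrite -!mulrA cp_thetaC !mulrA.
Qed.

Lemma cp_deg_tau g x : cp_deg g x -> cp_deg g (cp_tau x).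
Proof.
move=> xg; apply: cp_deg_sum => j; rewrite -[g]mulg1 -[g in (g * _)%g]mul1g.
by apply: cp_degM (cp_deg_base _ _); apply: cp_degM (cp_deg_base _ _) xg.
Qed.

(** Conjugation by u_g maps the copy of C onto itself, because [rho g] is bijective. *)
Lemma cp_cent_conj g z : cp_cent z -> cp_cent (u g * z * uV g).
Proof.
move=> zC c; have [r _ rK] := rho_bij F g; rewrite -(rK c) !mulrA -cp_u_base.
by rewrite -(mulrA (u g)) zC -!mulrA cp_base_uV.
Qed.

(* For [z] of degree [h g h^-1 g^-1], both sides are the traces of the torus
   axiom, computed in the dual bases [hh_basis] and [hh_cobasis]. *)
Lemma cp_torus g h z t : cp_cent z ->
  \sum_j cp_theta (uV h * 'b (xr j) *
            (z * (u g * cp_tau ('b t * 'b (xl j) * u h) * uV g))) =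
  \sum_j cp_theta (uV g * 'b (xr j) *
            (uV h * (z * cp_tau ('b t * 'b (xl j) * u g)) * u h)).
Proof.
move=> zC; pose L y := u g * cp_tau (y * u h * 'b t) * uV g * uV h.
have lL : linear L.
  move=> l x y; rewrite /L !mulrDl -!cp_scaleAl linearP.
  by rewrite mulrDr -cp_scaleAr !mulrDl -!cp_scaleAl.
pose M y := u g * cp_tau (y * u h) * uV g * uV h.
have lM : linear M.
  move=> l x y; rewrite /M mulrDl -cp_scaleAl linearP.
  by rewrite mulrDr -cp_scaleAr !mulrDl -!cp_scaleAl.
(* Swap the legs of the outer xi, and use [cp_tau_baseC] to carry [t] to the end of the argument of
   [tau]. *)
transitivity (cp_theta (z * \sum_j 'b (xl j) * L 'b (xr j))).
  rewrite (sandwich_sym lL) mulr_sumr linear_sum; apply: eq_bigr => j _ /=.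
  rewrite /L -(mulrA 'b t) cp_tau_baseC -(mulrA (uV h)) cp_thetaC.
  by rewrite !mulrA zC -!mulrA.
(* Now u_h t = h(t) u_h, and h(t) crosses the outer xi to its front. *)
transitivity (cp_theta (z * \sum_j 'b (rho F h t) * 'b (xl j) * M 'b (xr j))).
  rewrite (sandwich_mull lM); congr (cp_theta (z * _)); apply: eq_bigr => j _.
  by rewrite /L /M -!(mulrA 'b (xr j)) cp_u_base.
(* In this double sum [k] indexes the dual bases of the left-hand side and [j] the xi hidden in its
   [tau]. For the right-hand side the two roles are exchanged. *)
transitivity (\sum_j \sum_k cp_theta (z * ('b (xl k) * 'b t *
   ('b (xl j) * u g * ('b (xr k) * u h * (uV g * 'b (xr j) * u g) * uV g) * uV h)))).
  rewrite exchange_big /= mulr_sumr linear_sum; apply: eq_bigr => k _ /=.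
  rewrite -linear_sum -mulr_sumr -mulr_sumr -mulr_suml.
  rewrite -(sandwich_u _ (linear_mulr_mul ('b (xr k) * u h) (uV g))).
  have -> : \sum_j u g * 'b (xl j) * ('b (xr k) * u h * 'b (xr j) * uV g) =
            u g * cp_tau ('b (xr k) * u h) * uV g.
    by rewrite mulr_sumr mulr_suml; apply: eq_bigr => j _; rewrite !mulrA.
  rewrite /M; set Q := u g * _ * _.
  (* As [Q] commutes with C, [t] can pass it and then u_h^-1, becoming h(t), which cyclicity brings
     to the front. *)
  have QC : cp_cent Q by apply/cp_cent_conj/cp_tau_cent.
  rewrite -(mulrA _ 'b t) (mulrA 'b t) QC -(mulrA Q) cp_base_uV.
  by rewrite -(mulrA 'b _) (mulrA z) -zC -(mulrA 'b _) cp_thetaC -!mulrA.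
apply: eq_bigr => j _; rewrite {1}/cp_tau.
rewrite !mulr_sumr mulr_suml mulr_sumr linear_sum.
apply: eq_bigr => k _ /=; rewrite [RHS]cp_thetaC.
pose Y := z * 'b (xl k) * 'b t * 'b (xl j) * u g * 'b (xr k).
transitivity (cp_theta (Y * u h * uV g * 'b (xr j) * (u g * uV g) * uV h)).
  by rewrite /Y !mulrA.
by rewrite cp_umuV mulr1 [LHS]cp_thetaC /Y !mulrA.
Qed.
End Trace.

(** * Hochschild classes in the crossed product *)

Section HochschildClass.
Variables (K : fieldType) (gT : finGroupType) (C : falgType K).
Variables (F : twisted_frobenius gT C) (xi : tensor C C).
Hypothesis xiP : inverse_tensor F xi.
Local Notation A := (crossed_prod F).
Local Notation H := (hh_total F).
Local Notation "''b' c" := (cp_base F c) (at level 8, c at level 2).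
Local Notation u := (cp_u F).
Local Notation uV := (cp_uV F).
Local Notation tau := (cp_tau xi).
Implicit Types (x y z : A) (g h k : gT) (c d : C) (q r : H).

Definition hh_class x : H := dsum_mk (fun h => vpi (hh_sub F h) (x h)).

Lemma hh_class_linear : linear hh_class.
Proof.
move=> l x y; apply/dsumP => h; rewrite !dsum_mkE cp_addE cp_scaleE.
by rewrite linearP.
Qed.
HB.instance Definition _ := GRing.isLinear.Build K A H _ hh_class
  hh_class_linear.

(** A choice of representatives, in general not linear; linearity of [hh_tau] comes from its
    independence of the choice. *)
Definition hh_rep q : A := [ffun h => vrepr (dsum_proj q h)].

Lemma hh_repK : cancel hh_rep hh_class.
Proof. by move=> q; apply/dsumP => h; rewrite dsum_mkE ffunE vreprK. Qed.

Lemma hh_class_mono h c :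
  hh_class (cp_mono F h c) = dsum_in (vpi (hh_sub F h) c).
Proof.
apply/dsumP => k; rewrite !dsum_mkE cp_monoE.
have [<-|ne_hk] := eqVneq h k; first by rewrite dfwith_in.
by rewrite dfwith_out // linear0.
Qed.

(** In degree h the commutator has coefficient [hh_gen h c (x h)]. *)
Lemma hh_class_baseC c x : hh_class ('b c * x) = hh_class (x * 'b c).
Proof.
apply/dsumP => h; rewrite !dsum_mkE cp_base_mulE cp_mul_baseE.
apply/eqP; rewrite vpi_eq.
by apply: (hh_sub_subP F h (hh_sub F h)).1.
Qed.

(** In each degree [tau] kills the generators of [hh_sub], since they are commutators with C. *)
Lemma cp_tau_class0 x : hh_class x = 0 -> tau x = 0.
Proof.
move=> x0; rewrite [x]cp_sum_mono linear_sum big1 // => h _.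
pose f : {linear C -> A} := tau \o cp_mono F h.
have fx : x h \in hh_sub F h.
  rewrite -[x h]subr0 -vpi_eq linear0.
  by move/dsumP/(_ h): x0; rewrite !dsum_mkE => ->.
have sub : (hh_sub F h <= lker (linfun f))%VS.
  apply/hh_sub_subP => c d; rewrite memv_ker lfunE /= /hh_gen linearB linearB /=.
  by rewrite -cp_base_mono -cp_mono_base subr_eq0 (cp_tau_baseC xiP).
by move/(subvP sub): fx; rewrite memv_ker lfunE => /eqP.
Qed.

Definition hh_tau q : A := tau (hh_rep q).

Lemma hh_tau_class x : hh_tau (hh_class x) = tau x.
Proof.
apply/eqP; rewrite -subr_eq0 -linearB; apply/eqP/cp_tau_class0.
by rewrite linearB /= hh_repK subrr.
Qed.

Lemma hh_tau_linear : linear hh_tau.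
Proof.
move=> l q r; rewrite -[q]hh_repK -[r]hh_repK -linearP !hh_tau_class.
exact: linearP.
Qed.
HB.instance Definition _ := GRing.isLinear.Build K H A _ hh_tau hh_tau_linear.

Lemma hh_tau_cent q : cp_cent (hh_tau q).
Proof. exact: cp_tau_cent. Qed.

(** The factor from C in front of u_g x u_{g^-1} may be moved to the end modulo commutators, where
    it completes u_{g^-1} to u_g^-1. *)
Lemma hh_actE g q : hh_act g q = hh_class (u g * hh_rep q * uV g).
Proof.
rewrite [X in _ * X * _]cp_sum_mono mulr_sumr mulr_suml linear_sum.
apply: eq_bigr => h _ /=; rewrite /hh_act_comp /vquot_lift -hh_class_mono ffunE.
set c := vrepr _; have -> : cp_mono F (g * h * g^-1)%g (hh_T F h g c) =
    'b ((ce F)^-1 * (cc F g g^-1%g)^-1) *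
      (u g * cp_mono F h c * cp_mono F g^-1%g 1).
  rewrite /cp_u 2!cp_monoM cp_base_mono mul1r /hh_T.
  by congr cp_mono; rewrite rmorph1 mulr1 !mulrA.
by rewrite hh_class_baseC /cp_uV -lock !mulrA.
Qed.

(** [hh_m] is the coefficient of tau(c' u_g) c'' u_h, because u_g xi'' c'' = g(xi'' c'') u_g. *)
Lemma hh_mulE q r : hh_mul xi q r = hh_class (hh_tau q * hh_rep r).
Proof.
rewrite /hh_tau [hh_rep q]cp_sum_mono linear_sum mulr_suml linear_sum.
apply: eq_bigr => g _ /=.
rewrite [hh_rep r]cp_sum_mono mulr_sumr linear_sum; apply: eq_bigr => h _ /=.
rewrite /hh_mul_comp /vquot_lift2 /vquot_lift -hh_class_mono !ffunE.
congr hh_class; rewrite /hh_m casimirE => [|d l c c']; last first.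
  by rewrite !mulrDl -!scalerAl.
rewrite linear_sum mulr_suml; apply: eq_bigr => j _ /=.
by rewrite cp_base_mono cp_mono_base cp_monoM rmorphM /= !mulrA.
Qed.

Lemma hh_thetaE q : hh_theta q = cp_theta (hh_rep q).
Proof. by rewrite /cp_theta ffunE. Qed.

Lemma hh_comp_class g c : hh_class (cp_mono F g c) \in dsum_comp (hh F) g.
Proof. by rewrite hh_class_mono -[dsum_in _]lfunE memv_img ?memvf. Qed.

Lemma hh_compP g q :
  q \in dsum_comp (hh F) g -> exists c, q = hh_class (cp_mono F g c).
Proof.
case/memv_imgP => v _ ->; exists (vrepr v).
by rewrite hh_class_mono vreprK lfunE.
Qed.

Lemma hh_directv : directv (\sum_(g : gT) dsum_comp (hh F) g).
Proof.
apply/directv_sum_independent => q qP q0 g _.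
have qE h : h != g -> dsum_proj (q h) g = 0.
  move=> hg; have /memv_imgP[v _ ->] := qP h isT.
  by rewrite lfunE dsum_mkE dfwith_out.
have /memv_imgP[v _ qv] := qP g isT; rewrite qv lfunE /=.
suff -> : v = 0 by rewrite linear0.
have := congr1 (fun s : H => dsum_proj s g) q0.
pose p (s : H) := dsum_proj s g.
have pD : {morph p : a b / a + b} by move=> a b; rewrite /p dsum_mkE.
have p0 : p 0 = 0 by rewrite /p dsum_mkE.
rewrite -/(p _) (big_morph p pD p0) (bigD1 g) //= big1 => [|h hg]; last exact: qE.
by rewrite addr0 /p qv lfunE dsum_mkE dfwith_in -[dsum_proj 0 g]/(p 0) p0.
Qed.

Lemma hh_sum_comp : (\sum_(g : gT) dsum_comp (hh F) g)%VS = fullv.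
Proof.
apply/vspaceP => q; rewrite memvf -[q]hh_repK [hh_rep q]cp_sum_mono linear_sum.
by apply: memv_sumr => g _; apply: hh_comp_class.
Qed.

End HochschildClass.

(** * Identification with the centralizer *)

Section CrossedAlgebra.
Variables (K : fieldType) (gT : finGroupType) (C : falgType K).
Variables (F : twisted_frobenius gT C) (xi : tensor C C).
Hypothesis xiP : inverse_tensor F xi.
Variable t : C.
Hypothesis tau_t : \sum_j casl xi j * t * casr j = 1.
Local Notation A := (crossed_prod F).
Local Notation H := (hh_total F).
Local Notation "''b' c" := (cp_base F c) (at level 8, c at level 2).
Local Notation u := (cp_u F).
Local Notation uV := (cp_uV F).
Local Notation tau := (cp_tau xi).
Local Notation Phi := (@hh_tau K gT C F xi).
Implicit Types (x y z : A) (g h k : gT) (c d : C) (q r s : H).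

Lemma cp_tau_t : tau 'b t = 1.
Proof.
rewrite -(cp_base1 F) -tau_t linear_sum; apply: eq_bigr => j _ /=.
by rewrite !cp_baseM.
Qed.

(** Modulo commutators, the sum of the t xi' x xi'' is that of the xi'' t xi' x, and by symmetry of
    xi this is tau(t) x = x. *)
Lemma hh_class_tauK x : hh_class ('b t * tau x) = hh_class x.
Proof.
rewrite -[RHS](congr1 (@hh_class _ _ _ F) (mul1r x)) -cp_tau_t.
transitivity (hh_class (\sum_j 'b (casr j) * ('b t * 'b (casl xi j)) * x)).
  rewrite mulr_sumr !linear_sum; apply: eq_bigr => j _ /=.
  by rewrite !mulrA -hh_class_baseC !mulrA.
rewrite -mulr_suml -(sandwich_sym xiP (@linear_mulr _ _ _ F 'b t)).
by congr (hh_class (_ * _)); apply: eq_bigr => j _; rewrite mulrA.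
Qed.

Lemma hh_tauK q : hh_class ('b t * Phi q) = q.
Proof. by rewrite hh_class_tauK hh_repK. Qed.

Lemma hh_tau_inj : injective Phi.
Proof. by move=> q r qr; rewrite -[q]hh_tauK qr hh_tauK. Qed.

Lemma hh_tau_act g q : Phi (hh_act g q) = u g * Phi q * uV g.
Proof. by rewrite hh_actE (hh_tau_class xiP) (cp_tau_conj xiP). Qed.

Lemma hh_tau_mul q r : Phi (hh_mul xi q r) = Phi q * Phi r.
Proof.
by rewrite hh_mulE (hh_tau_class xiP) cp_tauMl //; apply: hh_tau_cent.
Qed.

Lemma hh_compE g q : q \in dsum_comp (hh F) g <-> cp_deg g (Phi q).
Proof.
split=> [/hh_compP[c ->] | qg].
  by rewrite (hh_tau_class xiP); apply/cp_deg_tau/cp_deg_mono.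
by rewrite -[q]hh_tauK qg cp_base_mono; apply: hh_comp_class.
Qed.

(** Since tau(t) = 1 and [tau] is self-adjoint, [cp_theta x] depends only on [tau x], hence only on
    the class. *)
Lemma hh_theta_class x : hh_theta (hh_class x) = cp_theta x.
Proof.
have E y : cp_theta y = cp_theta ('b t * tau y).
  by rewrite -(cp_theta_tau xiP) cp_tau_t mul1r.
by rewrite hh_thetaE E -/(Phi _) (hh_tau_class xiP) -E.
Qed.

Lemma hh_act_class g x : hh_act g (hh_class x) = hh_class (u g * x * uV g).
Proof.
by apply: hh_tau_inj; rewrite hh_tau_act !(hh_tau_class xiP) (cp_tau_conj xiP).
Qed.

(** Either factor of a product may be the averaged one, as [tau] is linear over the centralizer on
    both sides. *)
Lemma hh_mul_classl x q : hh_mul xi (hh_class x) q = hh_class (x * Phi q).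
Proof.
apply: hh_tau_inj; rewrite hh_tau_mul !(hh_tau_class xiP) cp_tauMr //.
exact: hh_tau_cent.
Qed.

Lemma hh_mul_classr x q : hh_mul xi q (hh_class x) = hh_class (Phi q * x).
Proof.
apply: hh_tau_inj; rewrite hh_tau_mul !(hh_tau_class xiP) cp_tauMl //.
exact: hh_tau_cent.
Qed.

(** * Axioms for the action and the multiplication *)

Lemma hh_act_linear g : linear (@hh_act K gT C F g).
Proof.
move=> l q r; apply: hh_tau_inj; rewrite linearP /= !hh_tau_act linearP /=.
by rewrite mulrDr mulrDl -cp_scaleAr -cp_scaleAl.
Qed.

Lemma hh_act1 q : hh_act 1%g q = q.
Proof.
apply: hh_tau_inj; rewrite hh_tau_act cp_u1 (hh_tau_cent xiP) -mulrA -cp_u1.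
by rewrite cp_umuV mulr1.
Qed.

(** u_g u_h and u_{gh} differ by an invertible element of C, which acts trivially on the centralizer
    by conjugation. *)
Lemma hh_actM g h q : hh_act (g * h)%g q = hh_act g (hh_act h q).
Proof.
apply: hh_tau_inj; rewrite !hh_tau_act; set z := Phi q.
set w := RHS; have wC : cp_cent w by do 2!apply: cp_cent_conj; apply: hh_tau_cent.
have wu : w * (u g * u h) = u g * u h * z.
  rewrite /w -!mulrA (mulrA (uV g)) cp_uVmu mul1r cp_uVmu mulr1.
  by rewrite !mulrA.
clearbody w; suff: u (g * h)%g * z = w * u (g * h)%g.
  by move=> ->; rewrite -mulrA cp_umuV mulr1.
have bK : 'b (cc F g h)^-1 * 'b (cc F g h) = 1.
  by rewrite -cp_baseM mulVr ?cc_unit // cp_base1.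
rewrite -[LHS]mul1r -[RHS]mul1r -bK -!mulrA; congr (_ * _).
by rewrite !mulrA wC -cp_uM -wu cp_uM mulrA.
Qed.

Lemma hh_act_in g h q :
  q \in dsum_comp (hh F) h -> hh_act g q \in dsum_comp (hh F) (g * h * g^-1)%g.
Proof.
move/hh_compE => qh; apply/hh_compE; rewrite hh_tau_act.
by apply: cp_degM (cp_deg_uV _ _); apply: cp_degM qh; apply: cp_deg_u.
Qed.

(** Conjugating c u_g by u_g gives u_g c, which is c u_g modulo commutators. *)
Lemma hh_act_id g q : q \in dsum_comp (hh F) g -> hh_act g q = q.
Proof.
case/hh_compP => c ->; rewrite hh_act_class {1}cp_mono_u mulrA -mulrA cp_umuV.
by rewrite mulr1 -hh_class_baseC -cp_mono_u.
Qed.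

(** For z in the centralizer, c u_g z = c (u_g z u_g^-1) u_g, and the conjugate commutes with c. *)
Lemma hh_mulC g q r : q \in dsum_comp (hh F) g ->
  hh_mul xi q r = hh_mul xi (hh_act g r) q.
Proof.
case/hh_compP => c ->; rewrite hh_mul_classl hh_mul_classr hh_tau_act.
have zC := cp_cent_conj g (hh_tau_cent xiP r).
rewrite cp_mono_u [in RHS]mulrA -zC !mulrA.
by rewrite -(mulrA _ (uV g)) cp_uVmu mulr1.
Qed.

Lemma hh_mul_in g h q r :
  q \in dsum_comp (hh F) g -> r \in dsum_comp (hh F) h ->
  hh_mul xi q r \in dsum_comp (hh F) (g * h)%g.
Proof.
move=> /hh_compE qg /hh_compE rh; apply/hh_compE; rewrite hh_tau_mul.
exact: cp_degM.
Qed.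

Lemma hh_mul_linearl r : linear ((@hh_mul K gT C F xi)^~ r).
Proof.
move=> l p q; apply: hh_tau_inj.
by rewrite linearP /= !hh_tau_mul linearP /= mulrDl -cp_scaleAl.
Qed.

Lemma hh_mul_linearr r : linear (@hh_mul K gT C F xi r).
Proof.
move=> l p q; apply: hh_tau_inj.
by rewrite linearP /= !hh_tau_mul linearP /= mulrDr -cp_scaleAr.
Qed.

(** With [hh_cobasis] this gives dual families in the sense of [vtrace_dual]: write q = [t z] with z
    = [Phi q] and expand the coefficient of z by [casl_dual]. *)
Definition hh_basis g j := hh_class ('b t * 'b (casl xi j) * u g).
Definition hh_cobasis g j q := cp_theta (uV g * 'b (casr j) * Phi q).

Lemma hh_cobasis_linear g j : scalar (hh_cobasis g j).
Proof.
move=> l q r; rewrite /hh_cobasis linearP /= mulrDr -cp_scaleAr.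
exact: linearP.
Qed.

Lemma hh_basisE g q : q \in dsum_comp (hh F) g ->
  q = \sum_j hh_cobasis g j q *: hh_basis g j.
Proof.
move/hh_compE => qg; rewrite -[LHS]hh_tauK /hh_cobasis qg; set c := Phi q g.
rewrite cp_mono_u {1}[c](casl_dual xiP) !linear_sum mulr_suml mulr_sumr linear_sum.
apply: eq_bigr => j _ /=; rewrite linearZ /= -cp_scaleAl -cp_scaleAr linearZ /=.
rewrite /hh_basis mulrA; congr (_ *: _).
by rewrite -!mulrA cp_thetaC -!mulrA cp_umuV mulr1 -cp_baseM cp_theta_base thetaC.
Qed.

Lemma hh_basis_in g j : hh_basis g j \in dsum_comp (hh F) g.
Proof. by rewrite /hh_basis -cp_baseM -cp_mono_u; apply: hh_comp_class. Qed.

Lemma hh_torus g h q :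
  q \in dsum_comp (hh F) (h * g * h^-1 * g^-1)%g ->
  vtrace (dsum_comp (hh F) h) (fun r => hh_mul xi q (hh_act g r)) =
  vtrace (dsum_comp (hh F) g) (fun r => hh_act h^-1%g (hh_mul xi q r)).
Proof.
move=> qd.
rewrite (vtrace_dual (phi := hh_cobasis h) (x := hh_basis h)); first last.
- exact: hh_basisE.
- move=> j; have E : (h = h * g * h^-1 * g^-1 * (g * h * g^-1))%g.
    by rewrite !mulgA !mulgKV mulgK.
  by rewrite [X in dsum_comp _ X]E; apply/hh_mul_in/hh_act_in/hh_basis_in.
- exact: hh_cobasis_linear.
- by move=> l p r; rewrite hh_act_linear hh_mul_linearr.
rewrite (vtrace_dual (phi := hh_cobasis g) (x := hh_basis g)); first last.
- exact: hh_basisE.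
- move=> j; have E : (g = h^-1 * (h * g * h^-1 * g^-1 * g) * h^-1^-1)%g.
    by rewrite mulgKV invgK !mulgA mulVg mul1g mulgKV.
  by rewrite [X in dsum_comp _ X]E; apply/hh_act_in/hh_mul_in/hh_basis_in.
- exact: hh_cobasis_linear.
- by move=> l p r; rewrite hh_mul_linearr hh_act_linear.
(* u_{h^-1} need not be u_h^-1, so the formula is derived from the group action law. *)
have actV r : Phi (hh_act h^-1%g r) = uV h * Phi r * u h.
  rewrite -[r in RHS]hh_act1 -(mulgV h) hh_actM [in RHS]hh_tau_act.
  by rewrite -!mulrA cp_uVmu mulr1 mulrA cp_uVmu mul1r.
under eq_bigr => j _ do
  rewrite /hh_cobasis hh_tau_mul hh_tau_act (hh_tau_class xiP).
under [RHS]eq_bigr => j _ do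
  rewrite /hh_cobasis actV hh_tau_mul (hh_tau_class xiP).
exact: cp_torus (hh_tau_cent xiP q).
Qed.

Lemma hh_unit : left_id (hh_class 'b t) (@hh_mul K gT C F xi) /\
  right_id (hh_class 'b t) (@hh_mul K gT C F xi).
Proof.
split=> q; apply: hh_tau_inj; rewrite hh_tau_mul (hh_tau_class xiP) cp_tau_t.
  exact: mul1r.
exact: mulr1.
Qed.

Lemma hh_theta_act g q : hh_theta (hh_act g q) = hh_theta q.
Proof.
by rewrite -[q]hh_repK hh_act_class !hh_theta_class cp_theta_conj.
Qed.

Lemma hh_theta_linear : scalar (@hh_theta K gT C F).
Proof.
move=> l q r; rewrite -[q]hh_repK -[r]hh_repK -linearP !hh_theta_class.
exact: linearP.
Qed.

(** * Non-degeneracy of the pairing *)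

Lemma cp_theta_nondegl g x : cp_deg g x ->
  (forall y, cp_deg g^-1%g y -> cp_theta (x * y) = 0) -> x = 0.
Proof.
move=> -> x0; suff -> : x g = 0 by rewrite linear0.
(* Testing against u_g^-1 b yields [theta F (x g * b)]. *)
apply: (theta_nondeg (t := F)) => b; have := x0 (uV g * 'b b).
rewrite cp_mono_u mulrA -(mulrA 'b _) cp_umuV mulr1 -cp_baseM cp_theta_base.
apply; rewrite -[X in cp_deg X]mulg1; exact: cp_degM (cp_deg_uV _ _) (cp_deg_base _ _).
Qed.

(** The pairing of q with the class of y is [cp_theta (Phi q * y)], where y runs over all of
    A_{g^-1}; so non-degeneracy of the trace form of A suffices. *)
Lemma hh_nondegl g q : q \in dsum_comp (hh F) g ->
  (forall r, r \in dsum_comp (hh F) g^-1%g -> hh_theta (hh_mul xi q r) = 0) ->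
  q = 0.
Proof.
move/hh_compE => qg q0; apply: hh_tau_inj; rewrite linear0 //.
apply: (cp_theta_nondegl qg) => y yg.
rewrite -hh_theta_class -hh_mul_classr q0 //.
by rewrite yg; apply: hh_comp_class.
Qed.

Lemma hh_nondegr g r : r \in dsum_comp (hh F) g^-1%g ->
  (forall q, q \in dsum_comp (hh F) g -> hh_theta (hh_mul xi q r) = 0) ->
  r = 0.
Proof.
move/hh_compE => rg r0; apply: hh_tau_inj; rewrite linear0 //.
apply: (cp_theta_nondegl rg) => x xg; rewrite invgK in xg.
rewrite cp_thetaC -hh_theta_class -hh_mul_classl r0 //.
by rewrite xg; apply: hh_comp_class.
Qed.

End CrossedAlgebra.

Theorem mainTheorem2 (gT : finGroupType) (K : fieldType) (C : falgType K)
    (F : twisted_frobenius gT C) (xi : tensor C C) :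
  separable_algebra C ->
  inverse_tensor F xi ->
  crossed_algebra (@dsum_comp K gT (hh F)) (@hh_act K gT C F)
    (@hh_theta K gT C F) (@hh_mul K gT C F xi).
Proof.
move=> sepC xiP; have [t tauP] := separable_casimir xiP sepC.
have inj := hh_tau_inj xiP tauP; have tauM := hh_tau_mul xiP.
have tauA := hh_tau_act xiP.
have act1 := hh_act1 xiP tauP; have actM := hh_actM xiP tauP.
split.
- exact: hh_directv.
- exact: hh_sum_comp.
- exact: (hh_act_linear xiP tauP).
- exact: act1.
- exact: actM.
- move=> g h y; split=> [yg | [x xh ->]]; last exact: (hh_act_in xiP tauP).
  exists (hh_act g^-1%g y); last by rewrite -actM mulgV act1.
  have := hh_act_in xiP tauP g^-1 yg.
  by rewrite invgK -(mulgA g) mulKg mulgKV.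
- by move=> g x; apply: (hh_act_id xiP tauP).
- by move=> a x y _ _; apply: (hh_theta_linear xiP tauP).
- by move=> g x _; apply: (hh_theta_act xiP tauP).
- exact: (hh_mul_linearl xiP tauP).
- exact: (hh_mul_linearr xiP tauP).
- by move=> x y z; apply: inj; rewrite !tauM mulrA.
- move=> g x y; apply: inj; rewrite tauM !tauA tauM !mulrA.
  by rewrite -(mulrA _ (cp_uV F g)) cp_uVmu mulr1.
- by move=> g h x y; apply: (hh_mul_in xiP tauP).
- by move=> g h x y xg _; apply: (hh_mulC xiP tauP).
- by move=> g h c; apply: (hh_torus xiP tauP).
- by exists (hh_class (cp_base F t)); apply: (hh_unit xiP tauP).
- by move=> g; split; [apply: (hh_nondegl xiP tauP) | apply: (hh_nondegr xiP tauP)].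
Qed.
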